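(* Let $\mathbb{K}$ be an algebraically closed field of characteristic $0$. Let $S=\mathbb{K}[z_1,\ldots,z_r,x_1,\ldots,x_s]$ be the graded polynomial ring with $\deg(z_i)=d_i\ge1$ and $\deg(x_i)=e_i\ge1$, and let $A=\mathbb{K}[x_1,\ldots,x_s]$ as a graded subalgebra. Let $P,Q_1,\ldots,Q_k\in S$ be homogeneous elements of positive degree. Suppose that: (1) $Q_1,\ldots,Q_k\in A$ and the ideal $(Q_1,\ldots,Q_k)$ is a Cohen-Macaulay, radical ideal in $A$; (2) $P$ does not have multiple factors and $P\notin(x_1,\ldots,x_s)$ in $S$; (3) for all $i\in\{1,\ldots,r\}$ such that $P$ depends on the variable $z_i$, we have $\mathrm{Disc}_{z_i}(P)\notin\mathfrak{q}\cdot S$ for any minimal prime $\mathfrak{q}$ of $(Q_1,\ldots,Q_k)$ in $A$. Then the ideal $(P,Q_1,\ldots,Q_k)$ is radical in $S$.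
   Context: An ideal $J\subset A$ is called Cohen-Macaulay if $A/J$ is a Cohen-Macaulay ring. $\mathrm{Disc}_{z_i}(P)$ denotes the resultant $\mathrm{Res}_{z_i}(P,\partial P/\partial z_i)$ with respect to $z_i$. ''Does not have multiple factors'' means square-free. *)

(* Defs.v *)
From HB Require Import structures.
From mathcomp Require Import all_boot all_order all_algebra.
From mathcomp Require Import ring_quotient boolp.
From mathcomp Require Import freeg mpoly.

Set Implicit Arguments.
Unset Strict Implicit.
Unset Printing Implicit Defensive.

Import GRing.Theory.

Local Open Scope ring_scope.

(* Ideals are boolean predicates, so that the structures [idealr] (proper     *)
(* ideals) and [prime_idealr] and the quotient [{ideal_quot I}] of            *)
(* ring_quotient can be used; [`[< _ >]] (boolp) turns a proposition into a   *)
(* boolean, so no decidability is implied.                                    *)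

Section Ideals.
Variable R : comNzRingType.

Definition ideal_gen (pT : predType R) (G : pT) : {pred R} :=
  fun x => `[< exists n (a g : 'I_n -> R),
                 (forall i, g i \in G) /\ x = \sum_(i < n) a i * g i >].

Definition radical_ideal (I : {pred R}) : Prop :=
  forall (x : R) (n : nat), x ^+ n \in I -> x \in I.

Definition maximal_ideal (I : idealr R) : Prop :=
  forall J : idealr R, {subset I <= J} -> {subset J <= I}.

Definition minimal_prime (I : {pred R}) (q : prime_idealr R) : Prop :=
  {subset I <= q} /\
  forall p : prime_idealr R,
    {subset I <= p} -> {subset p <= q} -> {subset q <= p}.

Definition noetherian : Prop :=
  forall I : idealr R, exists s : seq R, I =i ideal_gen s.

Definition regular_seq (s : seq R) : Prop :=
  (forall i, (i < size s)%N -> forall a,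
      a * s`_i \in ideal_gen (take i s) -> a \in ideal_gen (take i s))
  /\ 1 \notin ideal_gen s.

Definition is_max (E : nat -> Prop) (n : nat) : Prop :=
  E n /\ forall m, E m -> (m <= n)%N.

Definition is_depth (I : {pred R}) : nat -> Prop :=
  is_max (fun n => exists s : seq R,
            [/\ size s = n, {subset s <= I} & regular_seq s]).

(* lengths of the strict chains p_0 < p_1 < ... < p_n = I of prime ideals *)
Definition is_codim (I : {pred R}) : nat -> Prop :=
  is_max (fun n => exists p : nat -> prime_idealr R,
            (forall i, (i < n)%N ->
               {subset p i <= p i.+1} /\ ~ {subset p i.+1 <= p i})
            /\ p n =i I).

(* Definition of Eisenbud, Commutative Algebra, Section 18.2: a noetherian    *)
(* ring in which depth m = codim m for every maximal ideal m.                 *)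
Definition cohen_macaulay : Prop :=
  noetherian /\
  forall m : idealr R, maximal_ideal m ->
    exists n, is_depth m n /\ is_codim m n.

End Ideals.

(* The existential only equips [I] with its structure of (proper) ideal. *)
Definition cohen_macaulay_ideal (R : comNzRingType) (I : {pred R}) : Prop :=
  exists J : idealr R, J =i I /\ cohen_macaulay {ideal_quot J}.

Definition ideal_ext (R S : comNzRingType) (f : R -> S) (I : {pred R}) :
    {pred S} :=
  ideal_gen [pred y | `[< exists2 x, x \in I & y = f x >]].

Definition wdeg (n : nat) (w : 'I_n -> nat) (m : 'X_{1..n}) : nat :=
  (\sum_(i < n) w i * m i)%N.

Lemma wdeg0 n (w : 'I_n -> nat) : wdeg w 0%MM = 0%N.
Proof. by rewrite /wdeg big1 // => i _; rewrite mnm0E muln0. Qed.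

Lemma wdegD n (w : 'I_n -> nat) :
  {morph wdeg w : m1 m2 / (m1 + m2)%MM >-> (m1 + m2)%N}.
Proof.
move=> m1 m2; rewrite /wdeg -big_split /=.
by apply: eq_bigr => i _; rewrite mnmDE mulnDr.
Qed.

HB.instance Definition _ n (w : 'I_n -> nat) :=
  isMeasure.Build n (wdeg w) (wdeg0 w) (wdegD w).

Section Polynomials.
Variables (K : fieldType) (n : nat).
Implicit Types P : {mpoly K[n]}.

Definition depends_on P (i : 'I_n) : bool :=
  has (fun m : 'X_{1..n} => m i != 0%N) (msupp P).

Definition square_free P : Prop :=
  forall F G : {mpoly K[n]}, P = F ^+ 2 * G -> F \is a GRing.unit.

(* P as a univariate polynomial in 'X_i; its coefficients are polynomials in  *)
(* the other variables, viewed in {mpoly K[n]}.                               *)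
Definition upoly (i : 'I_n) P : {poly {mpoly K[n]}} :=
  mmap (polyC \o @mpolyC n K) (fun j => if j == i then 'X else ('X_j)%:P) P.

Definition Disc (i : 'I_n) P : {mpoly K[n]} :=
  resultant (upoly i P) (upoly i P^`M(i)).

End Polynomials.

(* In {mpoly K[r + s]} the variables z_i are 'X_(lshift s i) and the          *)
(* variables x_j are 'X_(rshift r j).                                         *)

Definition weights (r s : nat) (d : 'I_r -> nat) (e : 'I_s -> nat)
    (i : 'I_(r + s)) : nat :=
  match split i with inl a => d a | inr b => e b end.

(* the inclusion of K[x_1, ..., x_s] in K[z_1, ..., z_r, x_1, ..., x_s] *)
Definition incl (K : fieldType) (r s : nat) (p : {mpoly K[s]}) :
    {mpoly K[r + s]} :=
  p \mPo [tuple 'X_(rshift r j) | j < s].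

(* Main.v *)
(* Since P is homogeneous and not in (x), one of its monomials X^m0 in the    *)
(* variables z alone has a unit coefficient and strictly dominates the other  *)
(* monomials for a suitable weight on the z_i. Hence division by P over A is  *)
(* possible, and the remainders form a free A-module complementing (P).       *)
(* If F^n lies in (P, Q), let N be the remainder of F. For a minimal prime q  *)
(* of (Q), let L = Frac(A/q). A square factor of P in L[z] divides P and      *)
(* dP/dz_i, hence Disc_{z_i}(P), which is nonzero and free of z_i; so P is    *)
(* square-free in the factorial ring L[z], it divides N there, and N, being   *)
(* reduced, vanishes in L[z]. So the coefficients of N lie in all minimal     *)
(* primes of the radical ideal (Q), hence in (Q).                             *)
Require Import Defs.
From HB Require Import structures.
From mathcomp Require Import all_boot all_order all_algebra.
From mathcomp Require Import ring_quotient generic_quotient fraction boolp.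
From mathcomp Require classical_sets.
From mathcomp Require Import freeg mpoly.
From mathcomp Require Import ring zify.

Set Implicit Arguments.
Unset Strict Implicit.
Unset Printing Implicit Defensive.

Import GRing.Theory.

Local Open Scope ring_scope.

(** * Factorial domains *)

(** View [S] as [A[z]] through [split_mpoly]. Homogeneity and [P] not in [(x)] yield, by
    [leading_pure_monomial], a z-monomial [m0] of [P] with unit coefficient that strictly dominates
    the others for some weight. So every [F] equals a multiple of [P] plus a remainder [N] without
    monomials divisible by [m0] ([mpoly_division]).

    Let a power of [F] lie in [(P, Q)]. It suffices that the coefficients of [N] lie in [(Q)]. As
    [(Q)] is radical, a coefficient outside it avoids some minimal prime [q]
    ([minimal_prime_avoiding]). Over [L = Frac(A/q)] the image of [P] is square-free by the
    discriminant hypothesis ([square_free_fibre]), and [L[z]] is factorial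
    ([factorial_domain_mpoly]), so [P] divides [F] there, hence also [N]. A reduced multiple of [P]
    is zero ([reduced_multiple_eq0]), so all coefficients of [N] lie in [q], a contradiction.
    [radical_mpoly] assembles this argument. *)

Section Divisibility.
Variable D : idomainType.
Implicit Types p q x y : D.

Definition divides x y : Prop := exists z, y = z * x.

Definition prime_elt p : Prop :=
  [/\ p != 0, p \isn't a GRing.unit &
      forall x y, divides p (x * y) -> divides p x \/ divides p y].

Definition prime_factored x : Prop := exists u (s : seq D),
  [/\ u \is a GRing.unit, {in s, forall p, prime_elt p} &
      x = u * \prod_(p <- s) p].

(** Existence is enough: factorizations into prime, rather than irreducible, elements are
    automatically unique. *)
Definition factorial_domain : Prop := forall x, x != 0 -> prime_factored x.

Lemma divides_mulr x y z : divides x z -> divides x (y * z).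
Proof. by case=> t ->; exists (y * t); rewrite mulrA. Qed.

Lemma divides_trans x y z : divides x y -> divides y z -> divides x z.
Proof. by move=> xy [t ->]; apply: divides_mulr. Qed.

Lemma prime_ndvd_unit p u : prime_elt p -> u \is a GRing.unit -> ~ divides p u.
Proof.
case=> _ pU _ uU [t tp]; move: uU; rewrite tp unitrM.
by rewrite (negPf pU) andbF.
Qed.

Lemma prime_dvd_prod p u s : prime_elt p -> u \is a GRing.unit ->
  divides p (u * \prod_(q <- s) q) -> exists2 q, q \in s & divides p q.
Proof.
move=> pP uU; have [_ _ pM] := pP; elim: s => [|q s IH].
  by rewrite big_nil mulr1 => /prime_ndvd_unit-/(_ pP uU).
rewrite big_cons mulrCA => /pM[|/IH[q' q's]].
  by exists q; rewrite ?mem_head.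
by exists q'; rewrite // inE q's orbT.
Qed.

Lemma prime_factored1 p : prime_elt p -> prime_factored p.
Proof.
move=> pP; exists 1, [:: p]; rewrite unitr1 big_seq1 mul1r.
by split=> // q; rewrite inE => /eqP->.
Qed.

Lemma prime_factoredM x y :
  prime_factored x -> prime_factored y -> prime_factored (x * y).
Proof.
case=> u [s [uU sP ->]] [v [t [vU tP ->]]]; exists (u * v), (s ++ t).
rewrite unitrM uU vU big_cat /=; split=> //; last by ring.
by move=> p; rewrite mem_cat => /orP[/sP|/tP].
Qed.

Lemma prime_dvd_exp p x n : prime_elt p -> divides p (x ^+ n) -> divides p x.
Proof.
move=> pP; have [_ _ pM] := pP; elim: n => [|n IH].
  by rewrite expr0 => /prime_ndvd_unit-/(_ pP (unitr1 _)).
by rewrite exprS => /pM[].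
Qed.

Lemma prime_dvd_prime p t : prime_elt p -> prime_elt (t * p) ->
  t \is a GRing.unit.
Proof.
move=> [p0 pU _] [tp0 _ /(_ t p)[]]; first by exists 1; rewrite mul1r.
  case=> a ta; case/negP: pU; apply/unitrP.
  have t0 : t != 0 by apply: contraNneq tp0 => ->; rewrite mul0r.
  suff ap : a * p = 1 by exists a; rewrite [p * a]mulrC.
  by apply: (mulfI t0); rewrite mulr1 [in RHS]ta mulrCA.
case=> a pa; apply/unitrP; exists a.
suff at1 : a * t = 1 by rewrite [t * a]mulrC.
by apply: (mulIf p0); rewrite mul1r [in RHS]pa mulrA.
Qed.

(** Every prime factor of [x] divides [y]. Their product divides [y] as well, since two associated
    factors would give [x] a square factor. *)
Lemma divides_exp_square_free x y n : factorial_domain -> x != 0 ->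
  (forall a b, x = a ^+ 2 * b -> a \is a GRing.unit) ->
  divides x (y ^+ n) -> divides x y.
Proof.
move=> factD x0 sqf xyn; have [u [s [uU sP xE]]] := factD x x0.
have sy : {in s, forall p, divides p y}.
  move=> p ps; apply: prime_dvd_exp (sP p ps) _; apply: divides_trans xyn.
  by exists (u * \prod_(q <- rem p s) q); rewrite xE (big_rem p) //=; ring.
suff [z yz] : divides (\prod_(p <- s) p) y.
  by exists (z * u^-1); rewrite xE mulrA mulrVK.
have {xE} xE : x = \prod_(p <- s) p * u by rewrite mulrC.
(* The unit becomes an arbitrary cofactor [u], so that the induction can move primes into it. *)
elim: s u {uU} xE sP sy => [|p s IH] u xE sP sy.
  by rewrite big_nil; exists y; rewrite mulr1.
have [| q qs | q qs | z yz] := IH (u * p).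
- by rewrite xE big_cons; ring.
- by apply: sP; rewrite inE qs orbT.
- by apply: sy; rewrite inE qs orbT.
have pP := sP p (mem_head _ _); have [_ pU pM] := pP.
have := sy p (mem_head _ _); rewrite yz => /pM[[t ->]|].
  by exists t; rewrite big_cons mulrA.
rewrite -[\prod_(_ <- _) _]mul1r.
(* Here [p] divides another prime factor [q] of [x], so [p ^+ 2] divides [x]. *)
move=> /(prime_dvd_prod pP (unitr1 _))[q qs [t qE]].
case/negP: pU; apply: (sqf _ (t * \prod_(q <- rem q s) q * u)).
by rewrite xE big_cons (big_rem q) //= {1}qE; ring.
Qed.

End Divisibility.

Lemma factorial_domain_iso (D E : idomainType) (f : {rmorphism D -> E}) :
  bijective f -> factorial_domain E -> factorial_domain D.
Proof.
case=> g fK gK factE x x0.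
have gM : {morph g : a b / a * b}.
  by move=> a b; apply: (can_inj fK); rewrite rmorphM !gK.
have g1 : g 1 = 1 by apply: (can_inj fK); rewrite gK rmorph1.
have gU a : a \is a GRing.unit -> g a \is a GRing.unit.
  case/unitrP=> b [ba ab]; apply/unitrP; exists (g b).
  by rewrite -!gM ba ab.
have [|u [s [uU sP xE]]] := factE (f x).
  by apply: contra_neq x0 => fx0; apply: (can_inj fK); rewrite fx0 rmorph0.
exists (g u), (map g s); split; first exact: gU.
  move=> _ /mapP[p ps ->]; have [p0 pU pM] := sP p ps; split.
  - by apply: contra_neq p0 => gp; rewrite -[p]gK gp rmorph0.
  - by apply: contra pU => gp; rewrite -[p]gK rmorph_unit.
  move=> a b [z abz]; have [|[t ta]|[t tb]] := pM (f a) (f b).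
  + by exists (f z); rewrite -rmorphM abz rmorphM gK.
  + by left; exists (g t); rewrite -[a]fK ta gM.
  by right; exists (g t); rewrite -[b]fK tb gM.
by rewrite -[x]fK xE gM big_map (big_morph g gM g1).
Qed.

Import Pdiv.CommonIdomain Pdiv.Idomain.

(** * Gauss's lemma and factoriality of univariate polynomial rings *)

Section Gauss.
Variable D : idomainType.
Implicit Types (p c : D) (f g h a b : {poly D}).

(** Descent on the sum of the sizes: [p] divides the leading coefficient of [f] or [g]. Removing
    that leading term changes the factor by a multiple of [p] and lowers its size. *)
Lemma prime_polyC p : prime_elt p -> prime_elt p%:P.
Proof.
move=> [p0 pU pM]; split; first by rewrite polyC_eq0.
  by apply: contra pU; rewrite poly_unitE coefC eqxx => /andP[].
suff dvd_lead f g z : f * g = z * p%:P -> divides p (lead_coef f) ->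
    exists f', [/\ f != 0 -> (size f' < size f)%N, divides p%:P (f' * g) &
      divides p%:P f' -> divides p%:P f].
  move=> f g; have [N] := ubnP (size f + size g).
  elim: N f g => // N IH f g leN [z fgE].
  have [->|f0] := eqVneq f 0; first by left; exists 0; rewrite mul0r.
  have [->|g0] := eqVneq g 0; first by right; exists 0; rewrite mul0r.
  have /pM[pf|pg] : divides p (lead_coef f * lead_coef g).
  - by exists (lead_coef z); rewrite -lead_coefM fgE lead_coefM lead_coefC.
  - have [f' [/(_ f0) lt_f' /IH IHf' f'f]] := dvd_lead _ _ _ fgE pf.
    case: IHf' => [|/f'f|]; [|by left|by right].
    by rewrite -ltnS (leq_trans _ leN) // ltnS ltn_add2r.
  rewrite mulrC in fgE.
  have [g' [/(_ g0) lt_g' g'f g'g]] := dvd_lead _ _ _ fgE pg.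
  rewrite mulrC in g'f; case: (IH _ _ _ g'f) => [||/g'g]; [|by left|by right].
  by rewrite -ltnS (leq_trans _ leN) // ltnS ltn_add2l.
move=> fgE [t lcf]; exists (f - t%:P * p%:P * 'X^((size f).-1)); split.
- move=> f0; rewrite -[X in (_ < X)%N](@prednK (size f)) ?size_poly_gt0 // ltnS.
  apply/leq_sizeP => j; rewrite leq_eqVlt => /predU1P[<-|lt_j].
    by rewrite coefB -polyCM coefCM coefXn eqxx mulr1 -lcf subrr.
  rewrite coefB -polyCM coefCM coefXn (gtn_eqF lt_j) mulr0 subr0.
  by apply/(leq_sizeP _ _ (leqnn _)); rewrite (leq_trans (leqSpred _)).
- by exists (z - t%:P * 'X^((size f).-1) * g); rewrite !mulrBl fgE; ring.
case=> z' /eqP; rewrite subr_eq => /eqP ->.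
by exists (z' + t%:P * 'X^((size f).-1)); ring.
Qed.

(** Over a factorial [D] this says that the content is a unit, without mentioning gcds. *)
Definition primitive_poly g : Prop :=
  forall p, prime_elt p -> ~ divides p%:P g.

Hypothesis factD : factorial_domain D.

(** Clears denominators: the primes of [c] are cancelled one by one, each dividing the cofactor [h]
    because it cannot divide [g]. *)
Lemma primitive_dvd_cancel c g a : c != 0 -> primitive_poly g ->
  divides g (c%:P * a) -> divides g a.
Proof.
move=> /factD[u [s [uU sP ->]]] gP [h].
elim: s h sP => [|p s IH] h sP.
  rewrite big_nil mulr1 => hE; exists (u^-1%:P * h).
  by rewrite -mulrA -hE mulrA -polyCM mulVr // mul1r.
rewrite big_cons mulrCA polyCM => hE; have pP := sP p (mem_head _ _).
have [p0 _ _] := pP; have [_ _ pM] := prime_polyC pP.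
case: (pM h g).
- by rewrite -hE; exists ((u * \prod_(q <- s) q)%:P * a); ring.
- case=> h' h'E; apply: (IH h') => [q qs|].
    by apply: sP; rewrite inE qs orbT.
  have p0' : p%:P != 0 :> {poly D} by rewrite polyC_eq0.
  by apply: (mulfI p0'); rewrite [LHS]mulrA hE h'E; ring.
by move/(gP _ pP).
Qed.

(** Brings a factorization over the fraction field down to [D]: each prime of [c] divides [a] or [b]
    and is cancelled there, which keeps the sizes. *)
Lemma factor_scale_cancel c g a b : c != 0 -> c%:P * g = a * b ->
  exists a' b', [/\ g = a' * b', size a' = size a & size b' = size b].
Proof.
move=> /factD[u [s [uU sP ->]]].
elim: s a b sP => [|p s IH] a b sP.
  rewrite big_nil mulr1 => gE; exists (u^-1%:P * a), b.
  rewrite -mulrA -gE mulrA -polyCM mulVr // mul1r size_Cmul //.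
  by rewrite invr_eq0; apply: contraTneq uU => ->; rewrite unitr0.
rewrite big_cons mulrCA polyCM => gE; have pP := sP p (mem_head _ _).
have [p0 _ _] := pP; have [_ _ pM] := prime_polyC pP.
have sP' : {in s, forall q, prime_elt q}.
  by move=> q qs; apply: sP; rewrite inE qs orbT.
have p0' : p%:P != 0 :> {poly D} by rewrite polyC_eq0.
case: (pM a b).
- by rewrite -gE; exists ((u * \prod_(q <- s) q)%:P * g); ring.
- case=> a' aE; have [|a2 [b2 [g2 s2 t2]]] := IH a' b sP'.
    by apply: (mulfI p0'); rewrite [LHS]mulrA gE aE; ring.
  by exists a2, b2; split=> //; rewrite s2 aE mulrC size_Cmul.
case=> b' bE; have [|a2 [b2 [g2 s2 t2]]] := IH a b' sP'.
  by apply: (mulfI p0'); rewrite [LHS]mulrA gE bE; ring.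
by exists a2, b2; split=> //; rewrite t2 bE mulrC size_Cmul.
Qed.

(** Prime constants are pulled out one at a time. This ends because each step removes a prime factor
    from the leading coefficient. *)
Lemma content_primitive f : f != 0 -> exists2 g, primitive_poly g &
  size g = size f /\ exists2 h, prime_factored h & f = h * g.
Proof.
move=> f0; have [u [s [uU sP lcf]]] : prime_factored (lead_coef f).
  by apply: factD; rewrite lead_coef_eq0.
have [n] := ubnP (size s).
elim: n f f0 u s uU sP lcf => // n IH f f0 u s uU sP lcf; rewrite ltnS => le_n.
have [gP|/existsNP[p /not_implyP[pP /contrapT[g fE]]]] := EM (primitive_poly f).
  exists f => //; split=> //; exists 1; last by rewrite mul1r.
  by exists 1, [::]; rewrite big_nil unitr1 mulr1.
have [p0 pU _] := pP.
have lcfE : lead_coef f = lead_coef g * p by rewrite fE lead_coefM lead_coefC.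
have [|q qs [t qE]] := prime_dvd_prod (s := s) pP uU.
  by exists (lead_coef g); rewrite -lcf.
have tU : t \is a GRing.unit.
  by apply: (prime_dvd_prime pP); rewrite -qE; apply: sP.
have g0 : g != 0 by apply: contraNneq f0 => g0; rewrite fE g0 mul0r.
have [||||g' g'P [sz [h hF gE]]] := IH g g0 (u * t) (rem q s).
- by rewrite unitrM uU.
- by move=> r /mem_rem; apply: sP.
- by apply: (mulIf p0); rewrite -lcfE lcf (big_rem q) //= {1}qE; ring.
- by rewrite size_rem //; case: (s) qs le_n.
exists g' => //; split; first by rewrite sz fE mulrC size_Cmul.
exists (h * p%:P); last by rewrite fE gE mulrAC.
by apply: prime_factoredM hF (prime_factored1 (prime_polyC pP)).
Qed.

(** If [g] is not coprime to [x] over the fraction field, the gcd splits [g]. By irreducibility over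
    [D] the cofactor is constant, so [g] divides [x] up to a scalar. *)
Lemma irreducible_primitive_prime g : (1 < size g)%N -> primitive_poly g ->
  (forall a b, g = a * b -> (size a <= 1)%N || (size b <= 1)%N) ->
  prime_elt g.
Proof.
move=> g1 gP gI; have g0 : g != 0 by rewrite -size_poly_gt0 ltnW.
split=> [||x y [z xyE]] //.
  by apply: contraL g1; rewrite poly_unitE => /andP[/eqP->].
(* The relation [%|] is divisibility up to a nonzero constant, which primitivity of [g] removes. *)
suff [/dvdpP|/dvdpP] : g %| x \/ g %| y.
- case=> -[c q] /= c0 E; left; apply: (primitive_dvd_cancel c0 gP).
  by exists q; rewrite mul_polyC.
- case=> -[c q] /= c0 E; right; apply: (primitive_dvd_cancel c0 gP).
  by exists q; rewrite mul_polyC.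
have gxy : g %| x * y by rewrite xyE dvdp_mull.
have [cop|ncop] := boolP (coprimep g x).
  by right; rewrite mulrC Gauss_dvdpl // in gxy.
left; have /dvdpP[[c q] /= c0] := dvdp_gcdl g x.
rewrite -mul_polyC => /(factor_scale_cancel c0)[a [b [gE sa sb]]].
have d1 : (1 < size (gcdp g x))%N.
  rewrite ltn_neqAle eq_sym ncop size_poly_gt0.
  apply: contraNneq g0 => d0; rewrite gE mulf_eq0 -[b == 0]size_poly_eq0.
  by rewrite sb d0 size_poly0 orbT.
have a0 : a != 0 by apply: contraNneq g0 => a0; rewrite gE a0 mul0r.
have b0 : b != 0 by apply: contraNneq g0 => b0; rewrite gE b0 mulr0.
have a1 : size a = 1%N.
  have := gI _ _ gE; rewrite sb [(size (gcdp _ _) <= _)%N]leqNgt d1 orbF => a1.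
  by apply/eqP; rewrite eqn_leq a1 size_poly_gt0.
have : gcdp g x %= g.
  rewrite -dvdp_size_eqp ?dvdp_gcdl // -sb [in X in _ == X]gE size_mul // a1.
  by rewrite add1n.
by move=> /eqp_dvdl <-; apply: dvdp_gcdr.
Qed.

(** Induction on the size: a primitive part either splits into two nonconstant factors of smaller
    size, or is prime. *)
Theorem factorial_domain_poly : factorial_domain {poly D}.
Proof.
move=> f; have [N] := ubnP (size f).
elim: N f => // N IH f; rewrite ltnS => leN f0.
have [f1|f1] := leqP (size f) 1.
  have /factD[u [s [uU sP E]]] : f`_0 != 0.
    by apply: contraNneq f0 => E; rewrite (size1_polyC f1) E.
  exists u%:P, (map polyC s); rewrite (size1_polyC f1) E polyCM; split.
  - by rewrite poly_unitE coefC eqxx uU size_polyC (memPn _ u uU) ?unitr0.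
  - by move=> _ /mapP[p /sP pP ->]; apply: prime_polyC.
  by rewrite big_map rmorph_prod.
have [g gP [sz [h hF ->]]] := content_primitive f0.
apply: prime_factoredM hF _.
have g0 : g != 0 by rewrite -size_poly_gt0 sz ltnW.
have [[a [b [gE a1 b1]]]|nred] :=
    EM (exists a b, [/\ g = a * b, (1 < size a)%N & (1 < size b)%N]).
  have [a0 b0] : a != 0 /\ b != 0 by split; rewrite -size_poly_gt0 ltnW.
  move: leN; rewrite -sz gE size_mul // => leN.
  by apply: prime_factoredM; apply: IH => //; apply: leq_trans leN;
    move: a1 b1; lia.
apply/prime_factored1/irreducible_primitive_prime; rewrite ?sz // => a b gE.
case: leqP => //= a1; case: leqP => //= b1; case: nred.
by exists a, b.
Qed.

End Gauss.

(** * Factoriality of polynomial rings in several variables over a field *)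

Lemma eq_rmorph_mpoly (R : comNzRingType) (S : nzRingType) n
    (f g : {rmorphism {mpoly R[n]} -> S}) :
  (forall c, f c%:MP = g c%:MP) -> (forall i, f 'X_i = g 'X_i) -> f =1 g.
Proof.
move=> fgC fgX p; rewrite (mpolyE p) !rmorph_sum /=; apply: eq_bigr => m _.
rewrite -mul_mpolyC !rmorphM fgC mpolyXE_id !rmorph_prod /=; congr (_ * _).
by apply: eq_bigr => i _; rewrite !rmorphXn /= fgX.
Qed.

Lemma eq_rmorph_poly (R S : nzRingType) (f g : {rmorphism {poly R} -> S}) :
  (forall c, f c%:P = g c%:P) -> f 'X = g 'X -> f =1 g.
Proof.
move=> fgC fgX p; elim/poly_ind: p => [|p c IH]; first by rewrite !rmorph0.
by rewrite !rmorphD !rmorphM fgC fgX /= IH.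
Qed.

Section Muni.
Variables (R : comNzRingType) (n : nat).
Local Notation widen := (widen_ord (leqnSn n)).

Lemma muni_widen i : muni ('X_(widen i) : {mpoly R[n.+1]}) = ('X_i)%:P.
Proof.
rewrite muniE msuppX big_seq1 mcoeffX eqxx scale1r.
have -> : (U_(widen i)%MM : 'X_{1..n.+1}) ord_max = 0%N.
  by rewrite mnm1E -val_eqE /= ltn_eqF.
rewrite expr0 alg_polyC; congr ('X_[_])%:P; apply/mnmP => j.
by rewrite mnmE !mnm1E -!val_eqE.
Qed.

Lemma muni_max : muni ('X_ord_max : {mpoly R[n.+1]}) = 'X.
Proof.
rewrite muniE msuppX big_seq1 mcoeffX eqxx scale1r.
rewrite mnm1E eqxx expr1 -[X in _ = X]scale1r; congr (_ *: _).
rewrite -mpolyX0; congr 'X_[_]; apply/mnmP => j.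
by rewrite mnmE mnm1E mnm0E -val_eqE /= gtn_eqF.
Qed.

(** The inverse widens the coefficients and evaluates at the last variable; both composites are
    compared with the identity on generators. *)
Lemma muni_bij : bijective (@muni n R).
Proof.
have [h hC hX] : exists2 h : {rmorphism {poly {mpoly R[n]}} -> {mpoly R[n.+1]}},
    forall c, h c%:P = mwiden c & h 'X = 'X_ord_max.
  exists (horner_eval 'X_ord_max \o map_poly (@mwiden n R)) => [c|] /=.
    by rewrite /horner_eval map_polyC hornerC.
  by rewrite /horner_eval map_polyX hornerX.
have mwX i : mwiden ('X_i : {mpoly R[n]}) = 'X_(widen i).
  by rewrite mwidenX mnmwiden1.
exists h => [p|q].
  apply: (@eq_rmorph_mpoly _ _ _ (h \o @muni n R) idfun) => [c|i] /=.
    by rewrite muniC hC mwidenC.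
  have [<-|i_max] := eqVneq ord_max i; first by rewrite muni_max hX.
  have [j -> _] := unlift_some i_max.
  have -> : fintype.lift ord_max j = widen j by apply: val_inj; apply: lift_max.
  by rewrite muni_widen hC mwX.
apply: (@eq_rmorph_poly _ _ (@muni n R \o h) idfun) => [c|] /=.
  rewrite hC.
  apply: (@eq_rmorph_mpoly _ _ _ (@muni n R \o @mwiden n R) polyC).
    by move=> a /=; rewrite mwidenC muniC.
  by move=> i /=; rewrite mwX muni_widen.
by rewrite hX muni_max.
Qed.

End Muni.

Theorem factorial_domain_mpoly (L : fieldType) n :
  factorial_domain {mpoly L[n]}.
Proof.
elim: n => [p p0|n IH].
  exists p, [::]; rewrite big_nil mulr1; split=> //.
  rewrite (nvar0_mpolyC p) rmorph_unit // unitfE.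
  by apply: contraNneq p0 => E; rewrite (nvar0_mpolyC p) E.
exact: factorial_domain_iso (muni_bij L n) (factorial_domain_poly IH).
Qed.

(** * Quotients by primes and minimal primes *)

Section PrimeQuotient.
Local Open Scope quotient_scope.
Variables (R : comNzRingType) (q : prime_idealr R).
Local Notation Q := {ideal_quot q}.

(** Units and inverses are chosen classically, to make the quotient an integral domain with a field
    of fractions. *)
Definition quot_unit : {pred Q} := fun x => `[< exists y, y * x = 1 >].

Definition quot_inv (x : Q) : Q :=
  if pselect (exists y, y * x = 1) is left e then projT1 (cid e) else x.

Fact quot_mulVx : {in quot_unit, left_inverse 1 quot_inv *%R}.
Proof.
move=> x /asboolP xU; rewrite /quot_inv; case: pselect => // e.
by case: cid.
Qed.

Fact quot_intro_unit (x y : Q) : y * x = 1 -> x \in quot_unit.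
Proof. by move=> yx; apply/asboolP; exists y. Qed.

Fact quot_inv_out : {in [predC quot_unit], quot_inv =1 id}.
Proof. by move=> x /asboolPn xU; rewrite /quot_inv; case: pselect. Qed.

HB.instance Definition _ := GRing.ComNzRing_hasMulInverse.Build Q
  quot_mulVx quot_intro_unit quot_inv_out.

HB.instance Definition _ := GRing.ComUnitRing_isIntegral.Build Q
  (@Quotient.rquot_IdomainAxiom R q).

(** The field is the fraction field of [R/q]; what follows uses only the kernel of the map. *)
Lemma prime_ideal_kernel : exists (L : fieldType) (f : {rmorphism R -> L}),
  forall x, (f x == 0) = (x \in q).
Proof.
exists {fraction Q}, (@tofrac Q \o \pi_Q) => x /=.
rewrite tofrac_eq0 -[x in RHS]subr0 Quotient.idealrBE.
by rewrite !piE.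
Qed.

End PrimeQuotient.

Section MinimalPrime.
Variable R : comNzRingType.

Lemma prime_idealr_of_pred (q : {pred R}) :
  idealr_closed q -> prime_idealr_closed q ->
  exists p : prime_idealr R, p =i q.
Proof.
move=> qI qP.
pose q1 := isIdealr.Build R q qI.
pose q2 := isPrimeIdealrClosed.Build R q qP.
pose p : prime_idealr R := HB.pack q q1 q2.
by exists p.
Qed.

(* The complement of a multiplicative set that is maximal among those         *)
(* containing [a] and avoiding [I] is a minimal prime over [I].               *)
Lemma minimal_prime_avoiding (I : {pred R}) a :
  0 \in I -> {in I &, forall x y, x + y \in I} ->
  (forall c, {in I, forall x, c * x \in I}) ->
  radical_ideal I -> a \notin I ->
  exists2 q : prime_idealr R, minimal_prime I q & a \notin q.
Proof.
move=> I0 ID IM Irad aI.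
(* Containing [1] and [a] is required only of nonempty [W], so that the union of the empty chain
   qualifies in Zorn's lemma. *)
pose mult (W : R -> Prop) := (forall x, W x -> [/\ x \notin I, W 1 & W a]) /\
  (forall x y, W x -> W y -> W (x * y)).
have [|W [[WI WM] Wmax]] := @classical_sets.Zorn_bigcup R mult.
  move=> F Fmult Ftot; split=> [x [X FX Xx]|x y [X FX Xx] [Y FY Yy]].
    have [XI _] := Fmult _ FX; have [? ? ?] := XI _ Xx.
    by split=> //; exists X.
  have [XY|YX] := Ftot _ _ FX FY.
    by exists Y => //; have [_ YM] := Fmult _ FY; apply: YM => //; apply: XY.
  by exists X => //; have [_ XM] := Fmult _ FX; apply: XM => //; apply: YX.
have aX n : a ^+ n \notin I by apply: contra aI; apply: Irad.
(* A maximal [W] is nonempty, since the powers of [a] avoid [I]. *)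
have [W1 Wa] : W 1 /\ W a.
  have [[w Ww]|W0] := EM (exists w, W w); first by have [] := WI w Ww.
  exfalso; apply: (Wmax (fun x => exists n, x = a ^+ n)).
    split=> [x Wx|Wsup]; case: W0; first by exists x.
    by exists 1; apply: Wsup; exists 0%N.
  split=> [_ [n ->]|_ _ [n ->] [m ->]]; last by exists (n + m)%N; rewrite exprD.
  by split; [apply: aX | exists 0%N | exists 1%N].
(* By maximality, adjoining the powers of [x] to [W] meets [I] in some [w * x ^+ n]. Then
   [(w * x) ^+ n.+1] is in [I], hence so is [w * x]. *)
have WC x : ~ W x -> exists2 w, W w & w * x \in I.
  move=> Wx; apply: contrapT => WxI.
  have Wsub y : W y -> exists n, exists2 w, W w & y = w * x ^+ n.
    by move=> Wy; exists 0%N, y => //; rewrite mulr1.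
  apply: (Wmax (fun y => exists n, exists2 w, W w & y = w * x ^+ n)).
    split=> // Wsup; apply/Wx/Wsup; exists 1%N, 1 => //.
    by rewrite mul1r.
  split=> [_ [n [w Ww ->]]|_ _ [n [w Ww ->]] [m [v Wv ->]]]; last first.
    by exists (n + m)%N, (w * v); [apply: WM | rewrite exprD; ring].
  split; [|exact: Wsub|exact: Wsub].
  apply: contra_notN WxI => wxI; exists w => //; apply: (Irad _ n.+1).
  rewrite exprMn [x ^+ _]exprS exprSr.
  have -> : w ^+ n * w * (x * x ^+ n) = (w ^+ n * x) * (w * x ^+ n) by ring.
  exact: IM.
have WN x w : W w -> w * x \in I -> ~ W x.
  by move=> Ww wxI Wx; have [] := WI _ (WM _ _ Ww Wx); rewrite wxI.
have IW x : x \in I -> ~ W x by move=> xI /WI[]; rewrite xI.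
pose q : {pred R} := fun x => `[< ~ W x >].
have inq x : (x \in q) = `[< ~ W x >] by [].
have qI : idealr_closed q.
  split; first by apply/asboolP/IW.
    by apply/asboolPn => /(_ W1).
  move=> c x y /asboolP/WC[w Ww wx] /asboolP/WC[v Wv vy].
  apply/asboolP/(WN _ (w * v)); first exact: WM.
  have -> : w * v * (c * x + y) = v * c * (w * x) + w * (v * y) by ring.
  by apply: ID; apply: IM.
have qP : prime_idealr_closed q.
  move=> x y /asboolP xy; rewrite !inq -asbool_or; apply/asboolP.
  by apply: contrapT => /not_orP[/contrapT Wx /contrapT Wy]; apply/xy/WM.
have [p pq] := prime_idealr_of_pred qI qP.
exists p; last by rewrite pq inq; apply/asboolPn => /(_ Wa).
(* Minimality: for [x] in [p], some [w * x] is in [I] and so in [p'], while [w] in [W] lies outside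
   [p] and hence outside [p']. *)
split=> [x xI|p' Ip' p'p x]; first by rewrite pq inq; apply/asboolP/IW.
rewrite pq => /asboolP/WC[w Ww /Ip']; rewrite prime_idealrM => /orP[/p'p|//].
by rewrite pq => /asboolP/(_ Ww).
Qed.

End MinimalPrime.

(** * Division by a polynomial with a unit leading coefficient *)

Lemma seq_argmax (T : eqType) (s : seq T) (f : T -> nat) : s != [::] ->
  exists2 x, x \in s & forall y, y \in s -> (f y <= f x)%N.
Proof.
elim: s => // m s IH _; case: (altP (s =P [::])) => [->|/IH[g gs gmax]].
  by exists m => [|m']; rewrite inE // => /eqP->.
have [le_m|lt_m] := leqP (f m) (f g).
  by exists g => [|m']; rewrite inE ?gs ?orbT // => /predU1P[->|/gmax].
exists m => [|m']; rewrite inE ?eqxx // => /predU1P[->|/gmax] //.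
by move/leq_trans; apply; apply: ltnW.
Qed.

Section WeightedDivision.
Variables (n : nat) (w : 'I_n -> nat) (m0 : 'X_{1..n}).

Definition leading_monomial (A : nzRingType) (P : {mpoly A[n]}) : Prop :=
  forall m, m \in msupp P -> m != m0 -> (wdeg w m < wdeg w m0)%N.

(** The normal forms for division by a polynomial with leading monomial [m0]. *)
Definition reduced_mpoly (A : nzRingType) (F : {mpoly A[n]}) : Prop :=
  forall m, (m0 <= m)%MM -> F@_m = 0.

(** By additivity a single term is enough. If [m0] divides it, subtracting a multiple of [P]
    replaces it by terms of smaller weight. *)
Lemma mpoly_division (A : comUnitRingType) (P F : {mpoly A[n]}) :
  P@_m0 \is a GRing.unit -> leading_monomial P ->
  exists G, reduced_mpoly (F - P * G).
Proof.
move=> Pm0 Plead; pose red F := exists G, reduced_mpoly (F - P * G).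
have red0 : red 0 by exists 0 => m _; rewrite mulr0 subr0 mcoeff0.
have redD F1 F2 : red F1 -> red F2 -> red (F1 + F2).
  case=> [G1 r1] [G2 r2]; exists (G1 + G2) => m mm.
  by rewrite mulrDr opprD addrACA mcoeffD r1 // r2 // addr0.
suff redX m c : red (c *: 'X_[m]).
  by elim/mpolyind: F => // c m F _ _; apply: redD.
have [N] := ubnP (wdeg w m); elim: N m c => // N IH m c; rewrite ltnS => leN.
have [m0m|m0m] := boolP (m0 <= m)%MM; last first.
  exists 0 => m' m0m'; rewrite mulr0 subr0 mcoeffZ mcoeffX.
  have [mm'|_] := eqVneq m m'; last by rewrite mulr0.
  by rewrite mm' m0m' in m0m.
pose Q := P - P@_m0 *: 'X_[m0].
have PE : P = P@_m0 *: 'X_[m0] + Q by rewrite /Q addrC subrK.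
pose d := c / P@_m0.
suff [G GR] : red (- Q * (d *: 'X_[m - m0])).
  exists (d *: 'X_[m - m0] + G); suff -> : c *: 'X_[m] -
     P * (d *: 'X_[m - m0] + G) = - Q * (d *: 'X_[m - m0]) - P * G by [].
  have -> : 'X_[m] = 'X_[m - m0] * 'X_[m0] :> {mpoly A[n]}.
    by rewrite -mpolyXD submK.
  have cE : c%:MP = d%:MP * (P@_m0)%:MP :> {mpoly A[n]}.
    by rewrite -mpolyCM divrK.
  have PE' : P = (P@_m0)%:MP * 'X_[m0] + Q by rewrite mul_mpolyC -PE.
  rewrite -!mul_mpolyC cE mulrDr opprD addrA; congr (_ - _).
  by rewrite [X in _ - X * _]PE'; ring.
rewrite (mpolyE Q) -sumrN mulr_suml big_seq; apply: big_ind => // m1 m1Q.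
rewrite -scaleNr -!mul_mpolyC mulrACA -mpolyCM -mpolyXD mul_mpolyC.
apply: IH; apply: leq_trans leN.
have m1m0 : m1 != m0.
  apply: contraTneq m1Q => ->; rewrite mcoeff_msupp negbK /Q mcoeffB mcoeffZ.
  by rewrite mcoeffX eqxx mulr1 subrr.
have m1P : m1 \in msupp P.
  move: m1Q; rewrite !mcoeff_msupp mcoeffB mcoeffZ mcoeffX [m0 == _]eq_sym.
  by rewrite (negPf m1m0) mulr0 subr0.
by rewrite -[in X in (_ < X)%N](submK m0m) !wdegD addnC ltn_add2l Plead.
Qed.

(** If [g] is a monomial of [G] of maximal weight, only the pair [m0], [g] contributes to the
    monomial [m0 + g] of [P * G], so its coefficient is nonzero. *)
Lemma reduced_multiple_eq0 (A : idomainType) (P G : {mpoly A[n]}) :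
  P@_m0 != 0 -> leading_monomial P -> reduced_mpoly (P * G) -> G = 0.
Proof.
move=> Pm0 Plead red; apply/eqP; apply: contraT => G0.
have [g gG gmax] : exists2 g, g \in msupp G &
    forall m, m \in msupp G -> (wdeg w m <= wdeg w g)%N.
  by apply: seq_argmax; rewrite msupp_eq0.
have := red (m0 + g)%MM (lem_addr _ _).
have m0P : m0 \in msupp P by rewrite mcoeff_msupp.
rewrite mpolyME big_allpairs raddf_sum (bigD1_seq m0) ?msupp_uniq //=.
rewrite raddf_sum (bigD1_seq g) ?msupp_uniq //= mcoeffZ mcoeffX eqxx mulr1.
rewrite big1_seq => [|m /andP[mg mG]]; last first.
  by rewrite mcoeffZ mcoeffX eqm_add2l (negPf mg) mulr0.
rewrite big1_seq => [|m /andP[mm0 mP]]; last first.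
  rewrite raddf_sum big1_seq //= => m' m'G; rewrite mcoeffZ mcoeffX.
  suff /negPf-> : (m + m')%MM != (m0 + g)%MM by rewrite mulr0.
  apply: contraTneq (Plead m mP mm0) => /(congr1 (wdeg w)); rewrite !wdegD.
  by have := gmax m' m'G; lia.
rewrite !addr0 => /eqP; rewrite mulf_eq0 (negPf Pm0) /=.
by rewrite mcoeff_eq0 gG.
Qed.

End WeightedDivision.

Section RadicalModulo.
Variables (A : comUnitRingType) (I : {pred A}).
Hypotheses (I0 : 0 \in I) (ID : {in I &, forall x y, x + y \in I}).
Hypotheses (IM : forall c, {in I, forall x, c * x \in I}).
Hypothesis Irad : radical_ideal I.

(** Membership in the ideal generated by [P] and [I] is expressed as: up to a multiple of [P], all
    coefficients lie in [I]. The witness is the quotient [H] of the division of [F] by [P]. *)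
Theorem radical_mpoly n (w : 'I_n -> nat) m0 (P F : {mpoly A[n]}) k :
  P@_m0 \is a GRing.unit -> leading_monomial w m0 P ->
  (forall q : prime_idealr A, minimal_prime I q ->
    forall (L : fieldType) (f : {rmorphism A -> L}),
      (forall x, (f x == 0) = (x \in q)) -> square_free (map_mpoly f P)) ->
  (exists G, forall m, (F ^+ k - P * G)@_m \in I) ->
  exists G, forall m, (F - P * G)@_m \in I.
Proof.
move=> Pm0 Plead Psqf [G FkG].
have [H red] := mpoly_division F Pm0 Plead; exists H => m.
apply: contraT => /(minimal_prime_avoiding I0 ID IM Irad)[q qmin].
have [L [f fq]] := prime_ideal_kernel q; rewrite -fq.
pose fP := map_mpoly f P.
have fPm0 : fP@_m0 != 0.
  rewrite mcoeff_map_mpoly; apply: contraTneq (rmorph_unit f Pm0) => ->.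
  by rewrite unitr0.
have fP0 : fP != 0 by apply: contraNneq fPm0 => ->; rewrite mcoeff0.
have fPlead : leading_monomial w m0 fP.
  move=> m'; rewrite mcoeff_msupp mcoeff_map_mpoly => fPm'; apply: Plead.
  by rewrite mcoeff_msupp; apply: contraNneq fPm' => ->; rewrite raddf0.
have fdvd : divides fP (map_mpoly f F ^+ k).
  exists (map_mpoly f G); apply/eqP; rewrite -subr_eq0 -rmorphXn mulrC -rmorphM.
  rewrite -rmorphB; apply/eqP/mpolyP => m'; rewrite mcoeff_map_mpoly mcoeff0.
  by apply/eqP; rewrite fq; apply: qmin.1.
have [G' FG'] := divides_exp_square_free (@factorial_domain_mpoly L n) fP0
  (Psqf q qmin L f fq) fdvd.
suff N0 : map_mpoly f (F - P * H) = 0.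
  by rewrite -mcoeff_map_mpoly N0 mcoeff0 eqxx.
have NE : map_mpoly f (F - P * H) = fP * (G' - map_mpoly f H).
  by rewrite rmorphB rmorphM /= FG' -/fP; ring.
suff G0 : G' - map_mpoly f H = 0 by rewrite NE G0 mulr0.
apply: (reduced_multiple_eq0 fPm0 fPlead); rewrite -NE => m' m0m'.
by rewrite mcoeff_map_mpoly red // raddf0.
Qed.

End RadicalModulo.

(** * Choice of the weight *)

Section WeightSelection.
Variable n : nat.
Implicit Types (w : 'I_n -> nat) (m : 'X_{1..n}).

(** With a multinomial as weight, [wdeg] is the scalar product, and this is positivity of the
    squared norm of [m1 - m2]. *)
Lemma wdeg_AGM m1 m2 : m1 != m2 ->
  (2 * wdeg m1 m2 < wdeg m1 m1 + wdeg m2 m2)%N.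
Proof.
move=> m12; rewrite ltn_neqAle; rewrite /wdeg big_distrr /= -big_split /=.
have leif := leqif_sum (P := xpredT) (fun i _ => nat_Cauchy (m1 i) (m2 i)).
have -> : (\sum_i (m1 i * m1 i + m2 i * m2 i) =
  \sum_i (m1 i ^ 2 + m2 i ^ 2))%N by apply: eq_bigr => i _; rewrite -!mulnn.
rewrite leif.1 leif.2 andbT; apply: contra m12 => /forallP m12.
by apply/eqP/mnmP => i; apply/eqP/m12.
Qed.

Lemma wdeg_lin w1 w2 B m :
  wdeg (fun i => B * w1 i + w2 i)%N m = (B * wdeg w1 m + wdeg w2 m)%N.
Proof.
rewrite /wdeg big_distrr -big_split /=; apply: eq_bigr => i _.
by rewrite mulnDl mulnA.
Qed.

(* Among the monomials of top [d]-degree, the one of largest Euclidean norm   *)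
(* strictly maximises the scalar product with itself.                         *)
Lemma weight_separating (s : seq 'X_{1..n}) d D :
  (forall m, m \in s -> (wdeg d m <= D)%N) ->
  (exists2 m, m \in s & wdeg d m = D) ->
  exists w m0, [/\ m0 \in s, wdeg d m0 = D &
    forall m, m \in s -> m != m0 -> (wdeg w m < wdeg w m0)%N].
Proof.
move=> sD [m1 m1s m1D].
have [|m0] := @seq_argmax _ [seq m <- s | wdeg d m == D] (fun m => wdeg m m).
  rewrite -has_filter; apply/hasP; exists m1; rewrite //; exact/eqP.
rewrite mem_filter => /andP[/eqP m0D m0s] m0max.
(* [B] exceeds all scalar products of [m0] with elements of [s], so one unit of [d]-degree outweighs
   them. *)
pose B := (\sum_(m <- s) wdeg m0 m).+1.
exists (fun i => B * d i + m0 i)%N, m0; split=> // m ms mm0.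
rewrite !wdeg_lin m0D; have [mD|mD] := eqVneq (wdeg d m) D.
  rewrite mD ltn_add2l; have := m0max m.
  rewrite mem_filter mD eqxx ms => /(_ isT).
  by move: mm0; rewrite eq_sym => /wdeg_AGM; lia.
have mB : (wdeg m0 m < B)%N by rewrite ltnS (big_rem m) //= leq_addr.
have ltD : (wdeg d m < D)%N by rewrite ltn_neqAle mD sD.
have : (B * (wdeg d m).+1 <= B * D)%N by rewrite leq_mul2l ltD orbT.
by rewrite mulnS; lia.
Qed.

End WeightSelection.

(** * Ideals and resultants *)

Section IdealGen.
Variables (R : comNzRingType) (pT : predType R) (G : pT).

Lemma ideal_gen0 : 0 \in ideal_gen G.
Proof.
apply/asboolP; exists 0%N, (fun=> 0), (fun=> 0); split=> [[]//|].
by rewrite big_ord0.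
Qed.

Lemma ideal_gen_mem x : x \in G -> x \in ideal_gen G.
Proof.
move=> xG; apply/asboolP; exists 1%N, (fun=> 1), (fun=> x); split=> //.
by rewrite big_ord1 mul1r.
Qed.

Lemma ideal_genD : {in ideal_gen G &, forall x y, x + y \in ideal_gen G}.
Proof.
move=> _ _ /asboolP[n [a [g [gG ->]]]] /asboolP[m [b [h [hG ->]]]].
pose glue (u : 'I_n -> R) (v : 'I_m -> R) (i : 'I_(n + m)) :=
  match split i with inl j => u j | inr j => v j end.
apply/asboolP; exists (n + m)%N, (glue a b), (glue g h); split.
  by move=> i; rewrite /glue; case: split.
rewrite big_split_ord /glue; congr (_ + _); apply: eq_bigr => i _.
  by rewrite (unsplitK (inl i)).
by rewrite (unsplitK (inr i)).
Qed.

Lemma ideal_genM c : {in ideal_gen G, forall x, c * x \in ideal_gen G}.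
Proof.
move=> _ /asboolP[n [a [g [gG ->]]]]; apply/asboolP.
exists n, (fun i => c * a i), g; split=> //.
by rewrite mulr_sumr; apply: eq_bigr => i _; rewrite mulrA.
Qed.

Lemma ideal_gen_sum (I : Type) (s : seq I) (p : pred I) (F : I -> R) :
  (forall i, p i -> F i \in ideal_gen G) ->
  \sum_(i <- s | p i) F i \in ideal_gen G.
Proof.
move=> FG; apply: (big_ind (fun x => x \in ideal_gen G)) => //.
- exact: ideal_gen0.
- by move=> x y; apply: ideal_genD.
Qed.

End IdealGen.

Section Resultant.
Variable R : comNzRingType.
Implicit Types p q : {poly R}.

(** Allows a constant [q], as when [P] has degree one in the variable. The Sylvester matrix then
    consists of rows of [q] only, and expanding along one row shows that its determinant is a
    multiple of the constant. *)
Lemma resultant_in_idealW p q : (1 < size p)%N ->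
  exists u v, (resultant p q)%:P = u * p + v * q.
Proof.
move=> p1; have [q1|q1] := ltnP 1 (size q).
  by have [[u v] _ ->] := resultant_in_ideal p1 q1; exists u, v.
have [c qE] : exists c, q = c%:P by exists q`_0; apply: size1_polyC.
have sq : (size q).-1 = 0%N by case: (size q) q1 => [|[]].
have dS_gt0 : (0 < (size q).-1 + (size p).-1)%N by rewrite sq; move: p1; lia.
have cdvd i j : exists t, Sylvester_mx p q i j = t * c.
  rewrite Sylvester_mxE; case: split => k.
    by have := ltn_ord k; rewrite {2}sq.
  exists ((j - k == 0)%N%:R *+ (k <= j)%N); rewrite mulrnAl; congr (_ *+ _).
  have -> a : q`_a = if a == 0%N then c else 0 by rewrite qE coefC.
  by case: eqP; rewrite ?mul1r ?mul0r.
pose i0 := Ordinal dS_gt0.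
have [t tE] := boolp.choice (cdvd i0).
exists 0, (\sum_j t j * cofactor (Sylvester_mx p q) i0 j)%:P.
have qM x : x%:P * q = (x * c)%:P by rewrite qE polyCM.
rewrite mul0r add0r qM; congr (_%:P).
rewrite /resultant (expand_det_row _ i0) mulr_suml.
by apply: eq_bigr => j _; rewrite tE mulrAC.
Qed.

(** Serves to show that a discriminant is free of its variable, with [f] the substitution of zero
    for it. *)
Lemma resultant_fixed (f : {rmorphism R -> R}) p q :
  map_poly f p = p -> map_poly f q = q -> f (resultant p q) = resultant p q.
Proof.
move=> fp fq; rewrite /resultant -det_map_mx; congr (\det _).
apply/matrixP => i j; rewrite mxE Sylvester_mxE.
by case: split => k; rewrite rmorphMn /= -coef_map ?fp ?fq.
Qed.

End Resultant.

(** * Discriminants *)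

Section ZeroVar.
Variables (R : comNzRingType) (n : nat) (i : 'I_n).

(** Being fixed by this substitution encodes independence of ['X_i] in a form that ring morphisms on
    the coefficients preserve. *)
Definition zero_var : {mpoly R[n]} -> {mpoly R[n]} :=
  mmap (@mpolyC n R) (fun j => if j == i then 0 else 'X_j).

HB.instance Definition _ := GRing.RMorphism.copy zero_var
  (mmap (@mpolyC n R) (fun j => if j == i then 0 else 'X_j)).

Lemma zero_varC (c : R) : zero_var c%:MP = c%:MP.
Proof. by rewrite /zero_var mmapC. Qed.

Lemma zero_varXU j : zero_var 'X_j = if j == i then 0 else 'X_j.
Proof. by rewrite /zero_var mmapX mmap1U. Qed.

Lemma zero_varX (m : 'X_{1..n}) :
  zero_var 'X_[m] = if m i == 0%N then 'X_[m] else 0.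
Proof.
rewrite /zero_var mmapX /mmap1; have [mi|mi] := eqVneq (m i) 0%N.
  rewrite [RHS]mpolyXE_id; apply: eq_bigr => j _.
  by have [->|//] := eqVneq j i; rewrite mi !expr0.
by rewrite (bigD1 i) //= eqxx expr0n (negPf mi) mul0r.
Qed.

End ZeroVar.

Section Upoly.
Variables (K : fieldType) (n : nat) (i : 'I_n).
Implicit Types P : {mpoly K[n]}.

HB.instance Definition _ := GRing.RMorphism.copy (@upoly K n i)
  (mmap (polyC \o @mpolyC n K) (fun j => if j == i then 'X else ('X_j)%:P)).

Lemma upolyC (c : K) : upoly i c%:MP = c%:MP%:P.
Proof. by rewrite /upoly mmapC. Qed.

Lemma upolyXU j : upoly i ('X_j : {mpoly K[n]}) =
  if j == i then 'X else ('X_j)%:P.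
Proof. by rewrite /upoly mmapX mmap1U. Qed.

Lemma horner_upoly P : (upoly i P).['X_i] = P.
Proof.
apply: (@eq_rmorph_mpoly _ _ _ (horner_eval 'X_i \o @upoly K n i) idfun)
  => [c|j] /=.
  by rewrite upolyC /horner_eval hornerC.
rewrite upolyXU /horner_eval; case: eqP => [->|_]; first by rewrite hornerX.
by rewrite hornerC.
Qed.

Lemma horner0_upoly P : (upoly i P).[0] = zero_var i P.
Proof.
apply: (@eq_rmorph_mpoly _ _ _ (horner_eval 0 \o @upoly K n i) (zero_var i))
  => [c|j] /=.
  by rewrite upolyC /horner_eval hornerC zero_varC.
rewrite upolyXU zero_varXU /horner_eval.
by case: eqP => _; rewrite (hornerX, hornerC).
Qed.

Lemma map_zero_var_upoly P : map_poly (zero_var i) (upoly i P) = upoly i P.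
Proof.
apply: (@eq_rmorph_mpoly _ _ _ (map_poly (zero_var i) \o @upoly K n i)
  (@upoly K n i)) => [c|j].
  by rewrite /= upolyC map_polyC /= zero_varC.
rewrite /= upolyXU; have [_|ji] := eqVneq j i; first by rewrite map_polyX.
by rewrite map_polyC /= zero_varXU (negPf ji).
Qed.

Lemma upoly_zero_var P : upoly i (zero_var i P) = (zero_var i P)%:P.
Proof.
apply: (@eq_rmorph_mpoly _ _ _ (@upoly K n i \o zero_var i)
  (polyC \o zero_var i)) => [c|j] /=.
  by rewrite zero_varC upolyC.
rewrite zero_varXU; have [_|ji] := eqVneq j i; first by rewrite !raddf0.
by rewrite upolyXU (negPf ji).
Qed.

Lemma zero_var_Disc P : zero_var i (Disc i P) = Disc i P.
Proof. by apply: resultant_fixed; apply: map_zero_var_upoly. Qed.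

Lemma zero_var_id P : ~~ depends_on P i -> zero_var i P = P.
Proof.
move=> /hasPn Pi; rewrite [in LHS](mpolyE P) rmorph_sum [RHS]mpolyE /=.
apply: eq_big_seq => m /Pi; rewrite negbK => mi.
by rewrite -!mul_mpolyC rmorphM /= zero_varC zero_varX mi.
Qed.

Lemma depends_on_zero_var P : ~~ depends_on (zero_var i P) i.
Proof.
apply/hasPn => m; rewrite mcoeff_msupp; apply: contraR => mi.
rewrite (mpolyE P) rmorph_sum raddf_sum /= big1 // => m' _.
rewrite -mul_mpolyC rmorphM /= zero_varC zero_varX mcoeffCM.
case: eqP => [m'i|_]; last by rewrite mcoeff0 mulr0.
rewrite mcoeffX; have [mm'|_] := eqVneq m' m; last by rewrite mulr0.
by rewrite -mm' m'i in mi.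
Qed.

Lemma size_upoly P : (1 < size (upoly i P))%N = depends_on P i.
Proof.
apply/idP/idP => [|Pi].
  apply: contraLR => /zero_var_id <-; rewrite upoly_zero_var -leqNgt.
  exact: size_polyC_leq1.
rewrite ltnNge; apply/negP => /size1_polyC uP.
have PE : P = (upoly i P)`_0 by rewrite -[LHS]horner_upoly uP hornerC coefC.
have := depends_on_zero_var P.
by rewrite -horner0_upoly uP hornerC -PE Pi.
Qed.

(** The Bezout relation for the resultant, evaluated at ['X_i], where [upoly i P] takes the value
    [P]. *)
Lemma Disc_in_ideal P : depends_on P i ->
  exists a b, Disc i P = a * P + b * P^`M(i).
Proof.
rewrite -size_upoly => /(resultant_in_idealW (upoly i P^`M(i)))[u [v E]].
exists u.['X_i], v.['X_i].
have horM (a : {poly {mpoly K[n]}}) (Q : {mpoly K[n]}) :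
    a.['X_i] * Q = (a * upoly i Q).['X_i].
  by rewrite hornerM; congr (_ * _); rewrite horner_upoly.
by rewrite !horM -hornerD -E hornerC.
Qed.

(** Degrees in ['X_i] add up over a domain. *)
Lemma depends_onM P Q : P * Q != 0 -> depends_on P i -> depends_on (P * Q) i.
Proof.
rewrite mulf_eq0 negb_or -!size_upoly => /andP[P0 Q0] sP.
have u0 (R : {mpoly K[n]}) : R != 0 -> upoly i R != 0.
  by apply: contra_neq => uR; rewrite -(horner_upoly R) uR horner0.
rewrite rmorphM /= size_mul ?u0 // ltn_predRL.
by apply: (leq_add sP); rewrite size_poly_gt0 u0.
Qed.

End Upoly.

Lemma nonunit_depends_on (L : fieldType) n (F : {mpoly L[n]}) :
  F != 0 -> F \isn't a GRing.unit -> exists i, depends_on F i.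
Proof.
move=> F0 FU; apply: contrapT => Fi; case/negP: FU.
have FE : F = (F@_0)%:MP.
  apply/mpolyP => m; rewrite mcoeffC; have [->|m0] := eqVneq m 0%MM.
    by rewrite mulr1.
  rewrite mulr0; apply/eqP; rewrite mcoeff_eq0; apply/negP => mF.
  case: Fi; have [i mi] : exists i, m i != 0%N.
    apply: contrapT => mi; case/eqP: m0; apply/mnmP => i; rewrite mnm0E.
    by apply/eqP; apply: contrapT => /negP ?; apply: mi; exists i.
  by exists i; apply/hasP; exists m.
rewrite FE rmorph_unit // unitfE.
by apply: contraNneq F0 => E; rewrite FE E.
Qed.

(** * K[z, x] as A[z] *)

Section SplitVariables.
Variables (K : fieldType) (r s : nat).
Local Notation S := {mpoly K[r + s]}.
Local Notation A := {mpoly K[s]}.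

HB.instance Definition _ := GRing.RMorphism.copy (@incl K r s)
  (comp_mpoly [tuple 'X_(rshift r j) | j < s]).

Definition split_var (i : 'I_(r + s)) : {mpoly A[r]} :=
  match split i with inl a => 'X_a | inr b => ('X_b)%:MP end.

Definition split_mpoly : S -> {mpoly A[r]} :=
  mmap (@mpolyC r A \o @mpolyC s K) split_var.

HB.instance Definition _ := GRing.RMorphism.copy split_mpoly
  (mmap (@mpolyC r A \o @mpolyC s K) split_var).

Definition merge_mpoly : {mpoly A[r]} -> S :=
  mmap (@incl K r s) (fun a => 'X_(lshift s a)).

HB.instance Definition _ := GRing.RMorphism.copy merge_mpoly
  (mmap (@incl K r s) (fun a => 'X_(lshift s a))).

Lemma inclC (c : K) : incl r c%:MP = c%:MP :> S.
Proof. exact: comp_mpolyC. Qed.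

Lemma inclXU j : incl r ('X_j : A) = 'X_(rshift r j).
Proof. by rewrite /incl comp_mpolyXU -tnth_nth tnth_mktuple. Qed.

Lemma split_mpolyC (c : K) : split_mpoly c%:MP = c%:MP%:MP.
Proof. by rewrite /split_mpoly mmapC. Qed.

Lemma split_mpolyD : {morph split_mpoly : F G / F + G}.
Proof. exact: rmorphD. Qed.

Lemma split_mpolyM : {morph split_mpoly : F G / F * G}.
Proof. exact: rmorphM. Qed.

Lemma split_mpolyXl a : split_mpoly 'X_(lshift s a) = 'X_a.
Proof. by rewrite /split_mpoly mmapX mmap1U /split_var (unsplitK (inl a)). Qed.

Lemma split_mpolyXr b : split_mpoly 'X_(rshift r b) = ('X_b)%:MP.
Proof. by rewrite /split_mpoly mmapX mmap1U /split_var (unsplitK (inr b)). Qed.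

Lemma split_incl (f : A) : split_mpoly (incl r f) = f%:MP.
Proof.
apply: (@eq_rmorph_mpoly _ _ _ (split_mpoly \o @incl K r s) (@mpolyC r A)).
  by move=> c /=; rewrite inclC split_mpolyC.
by move=> j /=; rewrite inclXU split_mpolyXr.
Qed.

Lemma merge_mpolyC (f : A) : merge_mpoly f%:MP = incl r f.
Proof. by rewrite /merge_mpoly mmapC. Qed.

Lemma merge_mpolyXU a : merge_mpoly 'X_a = 'X_(lshift s a).
Proof. by rewrite /merge_mpoly mmapX mmap1U. Qed.

Lemma split_mpolyK : cancel split_mpoly merge_mpoly.
Proof.
apply: (@eq_rmorph_mpoly _ _ _ (merge_mpoly \o split_mpoly) idfun) => [c|i] /=.
  by rewrite split_mpolyC merge_mpolyC inclC.
case: (split_ordP i) => [a ->|b ->].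
  by rewrite split_mpolyXl merge_mpolyXU.
by rewrite split_mpolyXr merge_mpolyC inclXU.
Qed.

Lemma merge_mpolyK : cancel merge_mpoly split_mpoly.
Proof.
apply: (@eq_rmorph_mpoly _ _ _ (split_mpoly \o merge_mpoly) idfun) => [c|i] /=.
  by rewrite merge_mpolyC split_incl.
by rewrite merge_mpolyXU split_mpolyXl.
Qed.

Definition mjoin (m : 'X_{1..r}) (b : 'X_{1..s}) : 'X_{1..r + s} :=
  [multinom match split i with inl i => m i | inr j => b j end | i < r + s].

Lemma mjoin_lshift m b i : mjoin m b (lshift s i) = m i.
Proof. by rewrite mnmE (unsplitK (inl i)). Qed.

Lemma mjoin_rshift m b j : mjoin m b (rshift r j) = b j.
Proof. by rewrite mnmE (unsplitK (inr j)). Qed.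

Lemma mjoinP (M : 'X_{1..r + s}) m b :
  (M == mjoin m b) = ([multinom M (lshift s i) | i < r] == m) &&
    ([multinom M (rshift r j) | j < s] == b).
Proof.
apply/eqP/andP => [->|[/eqP<- /eqP<-]].
  by split; apply/eqP/mnmP => i; rewrite mnmE ?mjoin_lshift ?mjoin_rshift.
apply/mnmP => i; case: (split_ordP i) => [a ->|a ->].
  by rewrite mjoin_lshift mnmE.
by rewrite mjoin_rshift mnmE.
Qed.

Lemma split_mpolyX (M : 'X_{1..r + s}) : split_mpoly 'X_[M] =
  ('X_[[multinom M (rshift r j) | j < s]])%:MP
    * 'X_[[multinom M (lshift s i) | i < r]].
Proof.
rewrite (mpolyXE_id _ M) rmorph_prod big_split_ord /= mulrC; congr (_ * _).
  rewrite mpolyXE_id rmorph_prod; apply: eq_bigr => i _ /=.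
  by rewrite !rmorphXn /= split_mpolyXr mnmE.
rewrite mpolyXE_id; apply: eq_bigr => i _ /=.
by rewrite rmorphXn /= split_mpolyXl mnmE.
Qed.

(** Transfers homogeneity and derivatives between [S] and [A[z]], coefficient by coefficient. *)
Lemma mcoeff_split (F : S) m b : (split_mpoly F)@_m@_b = F@_(mjoin m b).
Proof.
elim/mpolyind: F => [|c M F _ _ IH]; first by rewrite raddf0 !mcoeff0.
have -> : split_mpoly (c *: 'X_[M] + F) =
    (c%:MP * 'X_[[multinom M (rshift r j) | j < s]])%:MP
      * 'X_[[multinom M (lshift s i) | i < r]] + split_mpoly F.
  rewrite rmorphD -mul_mpolyC [in LHS]rmorphM /= split_mpolyC split_mpolyX.
  by rewrite mulrA -mpolyCM.
rewrite (mcoeffD m) !mcoeffD IH; congr (_ + _).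
rewrite [in LHS]mcoeffCM [in LHS]mcoeffX mcoeffZ [in RHS]mcoeffX mjoinP.
case: eqP => _; last by rewrite !mulr0 mcoeff0.
by rewrite mulr1 mcoeffCM mcoeffX.
Qed.

Lemma wdeg_mjoin (d : 'I_r -> nat) (e : 'I_s -> nat) m b :
  wdeg (weights d e) (mjoin m b) = (wdeg d m + wdeg e b)%N.
Proof.
rewrite /wdeg big_split_ord; congr (_ + _)%N; apply: eq_bigr => i _.
  by rewrite mjoin_lshift /weights (unsplitK (inl i)).
by rewrite mjoin_rshift /weights (unsplitK (inr i)).
Qed.

Lemma split_mderiv (F : S) i :
  split_mpoly F^`M(lshift s i) = (split_mpoly F)^`M(i).
Proof.
apply/mpolyP => m; apply/mpolyP => b.
rewrite mcoeff_split !mcoeff_deriv mcoeffMn mcoeff_split mjoin_lshift.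
congr (F@_ _ *+ _); apply/mnmP => j; rewrite mnmDE.
case: (split_ordP j) => [a ->|a ->].
  by rewrite !mjoin_lshift mnmDE !mnm1E eq_lshift.
by rewrite !mjoin_rshift mnm1E eq_lrshift addn0.
Qed.

Lemma split_zero_var (F : S) i :
  split_mpoly (zero_var (lshift s i) F) = zero_var i (split_mpoly F).
Proof.
apply: (@eq_rmorph_mpoly _ _ _ (split_mpoly \o zero_var (lshift s i))
  (zero_var i \o split_mpoly)) => [c|j] /=.
  by rewrite zero_varC split_mpolyC zero_varC.
rewrite zero_varXU; case: (split_ordP j) => [a ->|a ->].
  rewrite eq_lshift split_mpolyXl zero_varXU.
  by case: eqP => _; rewrite ?raddf0 ?split_mpolyXl.
by rewrite eq_rlshift split_mpolyXr zero_varC.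
Qed.

End SplitVariables.

(** * Fibres over the minimal primes *)

Lemma map_mpoly_mderiv (R S : comNzRingType) (f : {rmorphism R -> S}) n
    (F : {mpoly R[n]}) i :
  map_mpoly f F^`M(i) = (map_mpoly f F)^`M(i).
Proof.
apply/mpolyP => m.
by rewrite mcoeff_map_mpoly !mcoeff_deriv mcoeff_map_mpoly raddfMn.
Qed.

Lemma map_mpoly_zero_var (R S : comNzRingType) (f : {rmorphism R -> S}) n
    (F : {mpoly R[n]}) i :
  map_mpoly f (zero_var i F) = zero_var i (map_mpoly f F).
Proof.
apply: (@eq_rmorph_mpoly _ _ _ (map_mpoly f \o zero_var i)
  (zero_var i \o map_mpoly f)) => [c|j] /=.
  by rewrite zero_varC !map_mpolyC zero_varC.
rewrite zero_varXU map_mpolyX zero_varXU.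
by case: eqP => _; rewrite ?raddf0 ?map_mpolyX.
Qed.

Section MainTheorem.
Variables (K : fieldType) (r s : nat).
Local Notation S := {mpoly K[r + s]}.
Local Notation A := {mpoly K[s]}.

(** Applied both to the extension of a prime [q] to [S] and to the ideal of [P] and [Q]. *)
Lemma merge_mem_ideal (pT : predType S) (G : pT) (J : {pred A}) (F : S) :
  (forall c, c \in J -> incl r c \in ideal_gen G) ->
  (forall m, (split_mpoly F)@_m \in J) -> F \in ideal_gen G.
Proof.
move=> JG FJ; rewrite -(split_mpolyK F) (mpolyE (split_mpoly F)) rmorph_sum.
apply: ideal_gen_sum => m _; rewrite -mul_mpolyC rmorphM /= merge_mpolyC mulrC.
exact/ideal_genM/JG.
Qed.

(** A nonunit [F] whose square divides the image of [P] involves some [z_i] and divides the image of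
    the [z_i]-derivative too, hence that of the discriminant. But this last image is nonzero and
    free of [z_i]. *)
Lemma square_free_fibre (q : prime_idealr A) (L : fieldType)
    (f : {rmorphism A -> L}) (P : S) :
  (forall c, (f c == 0) = (c \in q)) -> map_mpoly f (split_mpoly P) != 0 ->
  (forall i, depends_on P (lshift s i) ->
     Disc (lshift s i) P \notin ideal_ext (@incl K r s) q) ->
  square_free (map_mpoly f (split_mpoly P)).
Proof.
move=> fq P0 PDisc F G PE; apply: contraT => FU.
have F0 : F != 0 by apply: contraNneq P0 => F0; rewrite PE F0 expr0n mul0r.
have [i Fi] := nonunit_depends_on F0 FU.
have fzero H : map_mpoly f (split_mpoly (zero_var (lshift s i) H)) =
    zero_var i (map_mpoly f (split_mpoly H)).
  by rewrite split_zero_var map_mpoly_zero_var.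
have Pi : depends_on P (lshift s i).
  apply: contraT => /zero_var_id Pi.
  have := depends_on_zero_var i (map_mpoly f (split_mpoly P)).
  rewrite -fzero Pi PE expr2 -mulrA depends_onM // mulrA -expr2 -PE //.
have [a [b DE]] := Disc_in_ideal Pi.
set D := Disc _ _ in DE.
(* If the image vanished, all coefficients of [D] would lie in [q], putting [D] in the extended
   ideal. *)
have D0 : map_mpoly f (split_mpoly D) != 0.
  apply: contra (PDisc i Pi) => /eqP D0.
  apply: (@merge_mem_ideal _ _ q) => [c cq|m].
    by apply: ideal_gen_mem; apply/asboolP; exists c.
  by rewrite -fq -mcoeff_map_mpoly D0 mcoeff0.
have [H DH] : exists H, map_mpoly f (split_mpoly D) = F * H.
  have [h hE] : exists h : {rmorphism S -> {mpoly L[r]}},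
      forall H, map_mpoly f (split_mpoly H) = h H.
    by exists (map_mpoly f \o @split_mpoly K r s).
  have hP' : h P^`M(lshift s i) = (h P)^`M(i).
    by rewrite -!hE split_mderiv map_mpoly_mderiv.
  have hD : h (a * P + b * P^`M(lshift s i)) = h a * h P + h b * (h P)^`M(i).
    by rewrite -hP' -!(rmorphM h) -(rmorphD h).
  have -> : map_mpoly f (split_mpoly D) = h a * h P + h b * (h P)^`M(i).
    by rewrite hE; apply: etrans (congr1 h DE) hD.
  have -> : h P = F * F * G by rewrite -(hE P) PE expr2.
  rewrite (mderivM i (F * F)) (mderivM i F).
  (* The cofactor comes from the product rule: the derivative of [F * F * G] is
     [F * (2 F' G + F G')]. *)
  exists (h a * F * G + h b * (F^`M(i) * G *+ 2 + F * G^`M(i))); ring.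
have := depends_on_zero_var i (map_mpoly f (split_mpoly D)).
by rewrite -fzero zero_var_Disc DH depends_onM // -DH.
Qed.

Lemma ideal_gen_var_coeff (P : S) :
  P \notin ideal_gen [seq 'X_(rshift r j) | j : 'I_s] ->
  exists m, P@_(mjoin m 0%MM) != 0.
Proof.
move=> Pin; apply: contrapT => Pm; case/negP: Pin.
rewrite (mpolyE P) big_seq; apply: ideal_gen_sum => M MP.
have [j Mj] : exists j, M (rshift r j) != 0%N.
  apply: contrapT => Mj; apply: Pm.
  exists [multinom M (lshift s i) | i < r].
  suff <- : M = mjoin [multinom M (lshift s i) | i < r] 0%MM.
    by rewrite -mcoeff_msupp.
  apply/eqP; rewrite mjoinP eqxx /=; apply/eqP/mnmP => j; rewrite mnmE mnm0E.
  by apply/eqP; apply: contrapT => /negP ?; apply: Mj; exists j.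
rewrite -(@submK _ U_(rshift r j)%MM M) ?lep1mP // mpolyXD scalerAl.
by apply/ideal_genM/ideal_gen_mem/imageP; exists j.
Qed.

(** A z-monomial has [d]-degree at most [D]. In case of equality its coefficient in [A] has weight
    zero, so it is a constant because the [e j] are positive. The pure monomial of [P] attains [D],
    and [weight_separating] selects [m0] among such monomials. *)
Lemma leading_pure_monomial (d : 'I_r -> nat) (e : 'I_s -> nat) D (P : S) :
  (forall j, (1 <= e j)%N) -> P \is D.-homog for (wdeg (weights d e)) ->
  P \notin ideal_gen [seq 'X_(rshift r j) | j : 'I_s] ->
  exists w m0, (split_mpoly P)@_m0 \is a GRing.unit /\
    leading_monomial w m0 (split_mpoly P).
Proof.
move=> e1 /dhomogP PD /ideal_gen_var_coeff[m1 Pm1].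
have PD' m b : (split_mpoly P)@_m@_b != 0 -> (wdeg d m + wdeg e b = D)%N.
  by rewrite mcoeff_split -mcoeff_msupp => /PD <-; rewrite -wdeg_mjoin.
have wdeg_e0 b : wdeg e b = 0%N -> b = 0%MM.
  move=> /eqP; rewrite /wdeg sum_nat_eq0 => /forallP b0; apply/mnmP => j.
  rewrite mnm0E; apply/eqP; have := b0 j; rewrite implyTb muln_eq0.
  by rewrite -leqn0 leqNgt e1.
have [||w [m0 [m0P m0D m0lead]]] :=
  @weight_separating _ (msupp (split_mpoly P)) d D.
- move=> m; rewrite mcoeff_msupp => Pm; rewrite leqNgt; apply/negP => Dm.
  case/eqP: Pm; apply/mpolyP => b; rewrite mcoeff0; apply/eqP.
  by apply: contraT => /PD'; lia.
- exists m1; last first.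
    by have := PD' m1 0%MM; rewrite mcoeff_split wdeg0 addn0; apply.
  rewrite mcoeff_msupp; apply: contraNneq Pm1 => Pm1.
  by rewrite -mcoeff_split Pm1 mcoeff0.
exists w, m0; split=> //; set c := (split_mpoly P)@_m0.
have c0 : c != 0 by rewrite -mcoeff_msupp.
have cE : c = (c@_0)%:MP.
  apply/mpolyP => b; rewrite mcoeffC; have [->|b0] := eqVneq b 0%MM.
    by rewrite mulr1.
  rewrite mulr0; apply/eqP; apply: contraNT b0 => /PD'; rewrite m0D => De.
  by apply/eqP/wdeg_e0; lia.
rewrite cE rmorph_unit // unitfE.
by apply: contraNneq c0 => E; rewrite cE E.
Qed.

Lemma split_mem_ideal k (Q : k.-tuple A) (P F : S) :
  F \in ideal_gen (P :: [seq incl r f | f <- Q]) ->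
  exists G, forall m, (split_mpoly F - split_mpoly P * G)@_m \in ideal_gen Q.
Proof.
case/asboolP => n [a [g [gPQ ->]]].
apply: (big_ind (fun F => exists G, forall m,
  (split_mpoly F - split_mpoly P * G)@_m \in ideal_gen Q)).
- by exists 0 => m; rewrite mulr0 subr0 raddf0 mcoeff0 ideal_gen0.
- move=> F1 F2 [G1 FG1] [G2 FG2]; exists (G1 + G2) => m.
  have -> : split_mpoly (F1 + F2) - split_mpoly P * (G1 + G2) =
      (split_mpoly F1 - split_mpoly P * G1) +
      (split_mpoly F2 - split_mpoly P * G2).
    rewrite split_mpolyD.
    by rewrite mulrDr opprD addrACA.
  by rewrite mcoeffD; apply: ideal_genD; [apply: FG1 | apply: FG2].
move=> i _; have := gPQ i; rewrite inE => /predU1P[->|/mapP[c cQ ->]].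
  exists (split_mpoly (a i)) => m.
  by rewrite split_mpolyM [X in X - _]mulrC subrr mcoeff0 ideal_gen0.
exists 0 => m; rewrite mulr0 subr0 split_mpolyM split_incl mulrC mcoeffCM mulrC.
exact/ideal_genM/ideal_gen_mem.
Qed.

End MainTheorem.

Theorem lemma4p27 (K : closedFieldType) (charK : [pchar K] =i pred0)
  (r s k : nat) (d : 'I_r -> nat) (e : 'I_s -> nat)
  (d_ge1 : forall i, (1 <= d i)%N) (e_ge1 : forall j, (1 <= e j)%N)
  (P : {mpoly K[r + s]}) (Q : k.-tuple {mpoly K[s]})
  (P_homog : exists2 D, (0 < D)%N & P \is D.-homog for (wdeg (weights d e)))
  (Q_homog : forall j : 'I_k, exists2 D, (0 < D)%N
     & incl r (tnth Q j) \is D.-homog for (wdeg (weights d e)))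
  (Q_CM : cohen_macaulay_ideal (ideal_gen Q))
  (Q_radical : radical_ideal (ideal_gen Q))
  (P_sqfree : square_free P)
  (P_notin : P \notin ideal_gen [seq 'X_(rshift r j) | j : 'I_s])
  (P_Disc : forall i : 'I_r, depends_on P (lshift s i) ->
     forall q : prime_idealr {mpoly K[s]}, minimal_prime (ideal_gen Q) q ->
       Disc (lshift s i) P \notin ideal_ext (@incl K r s) q) :
  radical_ideal (ideal_gen (P :: [seq incl r f | f <- Q])).
Proof.
move=> F n /split_mem_ideal FnPQ; have [D _ PD] := P_homog.
have [w [m0 [Pm0 Plead]]] := leading_pure_monomial e_ge1 PD P_notin.
have [q qmin L f fq||G FG] := radical_mpoly (ideal_gen0 _) (@ideal_genD _ _ Q)
  (@ideal_genM _ _ Q) Q_radical Pm0 Plead (F := split_mpoly F) (k := n).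
- apply: square_free_fibre fq _ _ => [|i Pi]; last exact: P_Disc.
  (* The image of [P] is nonzero, since a ring morphism sends the unit coefficient at [m0] to a
     unit. *)
  apply/eqP => P0; have /negP[] : (map_mpoly f (split_mpoly P))@_m0 != 0.
    by rewrite mcoeff_map_mpoly -unitfE rmorph_unit.
  by rewrite P0 mcoeff0.
- by rewrite -rmorphXn.
(* The difference has all its coefficients in [(Q)], and the other summand is a multiple of [P]. *)
have -> : F = F - merge_mpoly G * P + merge_mpoly G * P by rewrite subrK.
apply: ideal_genD.
  apply: (@merge_mem_ideal _ _ _ _ _ (ideal_gen Q)) => [c|m].
    case/asboolP => l [a [g [gQ ->]]]; rewrite rmorph_sum.
    apply: ideal_gen_sum => i _; rewrite rmorphM /=.
    by apply/ideal_genM/ideal_gen_mem; rewrite inE map_f ?orbT.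
  rewrite rmorphB /= split_mpolyM merge_mpolyK mulrC; exact: FG.
by apply/ideal_genM/ideal_gen_mem/mem_head.
Qed.
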